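(* Let $n\ge 3$ and $r\ge 1$ be integers. The spectrum of $A_{n,r}$ consists of the eigenvalue $0$ with algebraic multiplicity $\mathrm{ord}_x\Phi_{n,r}$, together with exactly $\lfloor (r+2)/3\rfloor$ regular $n$-gons, all contained in the open disk of radius $(27/4)^{1/n}$ centered at the origin of $\mathbb C$, each $n$-gon having a vertex on the positive real axis.
   Context: For integers $n\ge3$ and $r\ge1$, the digraph $\Gamma_{n,r}$ has vertex set $V(\Gamma_{n,r})=\{1,2,\dots,rn-2r+2\}$ and directed edge set $E(\Gamma_{n,r})$ defined by $E(\Gamma_{n,1})=\{(j,j+1):1\le j\le n-1\}\cup\{(n,1)\}$; $E(\Gamma_{n,2})=E(\Gamma_{n,1})\cup\{(1,n+1)\}\cup\{(j,j+1):n+1\le j\le 2n-3\}\cup\{(2n-2,n)\}$; and for $r\ge3$, $E(\Gamma_{n,r})=E(\Gamma_{n,2})\cup\bigcup_{i=1}^{r-2}F_i$, where $F_i=\{(in-2i+2,\,in+n-2i+1)\}\cup\{(j,j+1):in+n-2i+1\le j\le in+2n-2i-3\}\cup\{(in+2n-2i-2,\,in+n-2i)\}$. (For $n=3$ the middle path parts are empty.) The adjacency matrix $A_{n,r}$ is the $(0,1)$-matrix indexed by $V(\Gamma_{n,r})$ whose $(u,v)$-entry is $1$ if and only if $(u,v)\in E(\Gamma_{n,r})$, and $\Phi_{n,r}=\det(xI-A_{n,r})\in\mathbb Z[x]$. For $\Phi\in\mathbb Z[x]$, $\mathrm{ord}_x\Phi$ denotes the order of vanishing of $\Phi$ at $x=0$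 (it may be $0$, in which case $0$ is not an eigenvalue). A ''regular $n$-gon'' in the spectrum means the vertex set of a regular $n$-gon centered at the origin, i.e. an orbit $\{\lambda\,e^{2\pi i j/n}:0\le j\le n-1\}$ with $\lambda\ne0$, all of whose elements are eigenvalues. *)

(* Defs.v *)
(* The field of complex numbers is R[i], where R : realType is the real line. *)
From mathcomp Require Import all_boot all_order all_algebra.
From mathcomp Require Import complex.
From mathcomp Require Import all_classical all_reals all_analysis.

Set Implicit Arguments.
Unset Strict Implicit.
Unset Printing Implicit Defensive.

Import Order.TTheory GRing.Theory Num.Theory.

Local Open Scope classical_set_scope.
Local Open Scope card_scope.
Local Open Scope complex_scope.
Local Open Scope ring_scope.

(* All subtractions below are on nat; none of them is truncated when 3 <= n. *)

Definition num_vertices (n r : nat) : nat := (r * n - 2 * r + 2)%N.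

Definition edges1 (n : nat) : rel nat := fun u v =>
  [|| [&& 1 <= u, u <= n - 1 & v == u.+1] | (u == n) && (v == 1)]%N.

Definition edges2_new (n : nat) : rel nat := fun u v =>
  [|| (u == 1) && (v == n + 1),
      [&& n + 1 <= u, u <= 2 * n - 3 & v == u.+1]
    | (u == 2 * n - 2) && (v == n)]%N.

Definition edgesF (n i : nat) : rel nat := fun u v =>
  [|| (u == i * n - 2 * i + 2) && (v == i * n + n - 2 * i + 1),
      [&& i * n + n - 2 * i + 1 <= u, u <= i * n + 2 * n - 2 * i - 3
        & v == u.+1]
    | (u == i * n + 2 * n - 2 * i - 2) && (v == i * n + n - 2 * i)]%N.

(* [iota 1 (r - 2)] enumerates 1, ..., r - 2 and is empty when r <= 2. *)
Definition edges (n r : nat) : rel nat := fun u v =>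
  [|| edges1 n u v, (2 <= r)%N && edges2_new n u v
    | has (fun i => edgesF n i u v) (iota 1 (r - 2))].

(* The vertex k of {1, ..., N} is represented by the ordinal k - 1 of 'I_N. *)
Definition adj (n r : nat) : 'M[int]_(num_vertices n r) :=
  \matrix_(u, v) (edges n r u.+1 v.+1)%:R.

Definition Phi (n r : nat) : {poly int} := char_poly (adj n r).

(* Order of vanishing at 0 of a nonzero polynomial: the index of its lowest
   nonzero coefficient. *)
Definition ord_x (p : {poly int}) : nat := find (fun c => c != 0) p.

Definition adjC (R : realType) (n r : nat) : 'M[R[i]]_(num_vertices n r) :=
  map_mx intr (adj n r).

Definition spectrum (K : fieldType) (m : nat) (A : 'M[K]_m) : set K :=
  [set z | eigenvalue A z].

Definition alg_mult (K : fieldType) (m : nat) (A : 'M[K]_m) (z : K) : nat :=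
  mup z (char_poly A).

Definition expi (R : realType) (t : R) : R[i] := cos t +i* sin t.

Definition regular_ngon (R : realType) (n : nat) (P : set R[i]) : Prop :=
  exists2 lambda : R[i], lambda != 0 &
    P = [set lambda * expi (2 * pi * j%:R / n%:R) | j in `I_n].

Definition ngons_in (R : realType) (n : nat) (S : set R[i]) : set (set R[i]) :=
  [set P | regular_ngon n P /\ P `<=` S].

Definition open_disk (R : realType) (rho : R) : set R[i] :=
  [set z | `|z| < rho%:C].

(* Main.v *)
Require Import Defs.
From mathcomp Require Import all_boot all_order all_algebra.
From mathcomp Require Import perm separable.
From mathcomp Require Import zify ring lra.
From mathcomp Require Import complex.
From mathcomp Require Import all_classical all_reals all_analysis.

(** Write n = m + 2.  The digraph is a strip of r directed n-cycles: with
    spine vertices s_(-1), s_0, ..., s_r joined by s_k -> s_(k-1), the k-th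
    cycle climbs from s_(k-2) to s_k along m edges and comes back through
    s_(k-1), so that two cycles meet exactly when their indices differ by at
    most 2.  The nonzero spectrum is therefore governed by the polynomials
    J_0 = J_1 = J_2 = 1, J_(k+3) = J_(k+2) + X J_k: the coefficient of X^j in
    J_(r+2) counts the choices of j pairwise disjoint cycles.

    The determinant.  For l <> 0, the equations (l - A) v = 0 can be solved from
    s_r downwards; this gives v explicitly in terms of l and J_k(- l^-n), and
    the only equation left, that of s_(-1), fails by l^(r+2) J_(r+2)(- l^-n)
    ([charmx_mul_weight]).  By Cramer's rule det (l - A) is this number times
    one cofactor, and the same order of elimination makes that cofactor
    triangular up to a permutation, hence equal to a power of l up to sign
    ([cofactor_second_last]).  Comparing degrees and leading coefficients fixes
    the power and the sign, whence the factorisation [char_poly_adj] of the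
    characteristic polynomial as X^e times the product of the X^n - u, where
    J_(r+2) is the product of the 1 + u X.

    The roots.  It remains to see that J_k has k / 3 distinct roots, all real and
    smaller than - 4 / 27.  If z has positive imaginary part, then the complex
    numbers J_k(z), J_(k+1)(z), J_(k+2)(z), z J_k(z) occur in this angular order
    in a sector narrower than a half plane, and the recurrence preserves this
    configuration ([sector_step]); so J_k(z) is not 0.  The
    argument only uses the area form on the plane and its behaviour under
    multiplication by z.  It applies verbatim to dual numbers x + eps, where
    J_k(x + eps) = J_k(x) + J_k'(x) eps, and then it says that J_k and J_k' have
    no common real root.  Finally J_k >= (2/3) J_(k-1) > 0 on [- 4/27, +oo[.

    Each u contributes the n-th roots of u, a regular n-gon with a positive
    vertex, and u < 27 / 4 bounds its radius. *)

Set Implicit Arguments.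
Unset Strict Implicit.
Unset Printing Implicit Defensive.

Import Order.TTheory GRing.Theory Num.Theory.

(** * The edges of the digraph, block by block *)

(** Vertices are numbered from 0 in this part: s_0 = 0, s_(-1) = 1,
    s_c = c m + 1 for c > 0.  The predicate leaves s_(-1) out, because its single
    outgoing edge runs along the first cycle, like that of an interior vertex. *)
Definition spine (m u : nat) : bool := (u == 0) || (1 < u) && (m %| u.-1).

(** The successor that every vertex has: s_k goes back to s_(k-1), and the
    other vertices move forward along the path that they lie on. *)
Definition down (m u : nat) : nat :=
  if u == 0 then 1 else if u == m.+1 then 0
  else if (1 < u) && (m %| u.-1) then u - m else u.+1.

(** From a spine vertex, the first vertex of the path that opens the cycle
    two steps later.  Near the end of the strip it is out of range, which is how
    the missing edges are encoded. *)
Definition up (m u : nat) : nat := if u == 0 then m.+2 else u + m.+1.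

Lemma num_verticesE m r : num_vertices m.+2 r = r * m + 2.
Proof. by rewrite /num_vertices; nia. Qed.

Lemma spine_block m c : 0 < m -> 0 < c -> spine m (c * m + 1).
Proof.
by move=> m0 c0; rewrite /spine addn1 /= dvdn_mull // ltnS muln_gt0 c0 m0.
Qed.

Lemma spine_interior m b o : o.+1 < m -> spine m (b * m + 2 + o) = false.
Proof.
move=> om; rewrite /spine (_ : (b * m + 2 + o).-1 = b * m + o.+1); last by lia.
by rewrite dvdn_addr ?dvdn_mull // gtnNdvd // andbF orbF; lia.
Qed.

Lemma vertexP m r u : 0 < m -> u < r * m + 2 ->
  [\/ u = 0, u = 1, (exists2 c, 0 < c <= r & u = c * m + 1)
   | exists b o, [/\ b < r, o.+1 < m & u = b * m + 2 + o]].
Proof.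
move=> m0 hu; case: u hu => [| [|u]] hu; [by constructor 1 | by constructor 2 | ].
have ub : u %/ m < r by rewrite ltn_divLR //; lia.
have := ltn_pmod u m0; rewrite leq_eqVlt => /orP[/eqP o1|o1].
- constructor 3; exists (u %/ m).+1 => //.
  by have := divn_eq u m; lia.
- constructor 4; exists (u %/ m), (u %% m); split=> //.
  by have := divn_eq u m; lia.
Qed.

Lemma down_spine m c : 0 < m -> 0 < c ->
  down m (c * m + 1) = if c == 1 then 0 else c.-1 * m + 1.
Proof.
move=> m0 c0; have := spine_block m0 c0.
have c1 : (c * m + 1 == 0) = false by lia.
rewrite /spine /down c1 /= => ->.
by case: eqP => [h|h]; case: eqP; nia.
Qed.

Lemma edges_hasP n r u v :
  reflect (exists2 i, 0 < i /\ i + 2 <= r & edgesF n i u v)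
    (has (fun i => edgesF n i u v) (iota 1 (r - 2))).
Proof.
apply: (iffP hasP) => -[j].
  by rewrite mem_iota => hj ?; exists j => //; lia.
by move=> hj ?; exists j => //; rewrite mem_iota; lia.
Qed.

(** An edge of the family F_i leaves the spine vertex s_c only for i = c (start of
    a path) and i = c - 2 (edge back to s_(c-1)), and the interior of block b,
    counted from 0, only for i = b - 1. *)
Lemma edgesE m r u v : 0 < m -> 0 < r -> u < r * m + 2 -> v < r * m + 2 ->
  edges m.+2 r u.+1 v.+1 = (v == down m u) || spine m u && (v == up m u).
Proof.
move=> m0 r0 hu hv.
case: (vertexP m0 hu) => [->|->| [c c0 uE]| [b [ o [br om uE]]]].
- rewrite /edges (introF (edges_hasP _ _ _ _)); last first.
    by move=> [i [i0 ir]]; rewrite /edgesF; nia.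
  rewrite /edges1 /edges2_new /down /spine /up /=.
  have -> : (1 < r) = (m + 2 < r * m + 2) by nia.
  lia.
- rewrite /edges (introF (edges_hasP _ _ _ _)); last first.
    by move=> [i [i0 ir]]; rewrite /edgesF; nia.
  rewrite /edges1 /edges2_new /down /spine /up /=.
  rewrite orbF (_ : (1 == m.+1) = false); last by lia.
  by apply/idP/idP; lia.
- have sp : spine m u by rewrite uE; apply: spine_block; lia.
  have u1 : 1 < u by nia.
  have -> : down m u = if c == 1 then 0 else c.-1 * m + 1.
    by rewrite uE down_spine //; case/andP: c0.
  rewrite sp (_ : up m u = c.+1 * m + 2); last by rewrite /up; case: eqP; nia.
  apply/idP/idP.
    case/or3P.
    + by rewrite /edges1 uE; have [c1|c1] := eqVneq c 1; [subst c; lia | nia].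
    + rewrite /edges2_new uE; have [c1|c1] := eqVneq c 1; first by subst c; lia.
      have [c2|c2] := eqVneq c 2; [subst c; lia | nia].
    + case/edges_hasP => i [i0 ir]; rewrite /edgesF => /or3P[].
      * move=> h; have ic : i = c by nia.
        by subst i; rewrite orbC; case: eqP; lia.
      * move=> h; have h1 : i < c by nia.
        have h2 : c < i.+2 by nia.
        have ic : c = i.+1 by lia.
        subst c; nia.
      * move=> h; have ic : c = i + 2 by nia.
        subst c; rewrite (_ : (i + 2 == 1) = false); lia.
  case/orP=> [/eqP ->|/= /eqP vE].
    case: eqP => [c1|c1]; first by apply/or3P/Or31; rewrite /edges1; lia.
    have [c2|c2] := eqVneq c 2.
      by apply/or3P/Or32; rewrite /edges2_new uE c2; lia.
    apply/or3P/Or33/edges_hasP; exists (c - 2); first by lia.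
    rewrite /edgesF uE (_ : c = (c - 2).+2); last by lia.
    by move: (c - 2) => i; lia.
  have h : c.+1 < r by nia.
  apply/or3P/Or33/edges_hasP; exists c; first by lia.
  rewrite /edgesF uE vE; lia.
- have sp : spine m u = false by rewrite uE spine_interior.
  have nsp c : 0 < c -> u <> c * m + 1.
    by move=> c0 uc; move: sp; rewrite uc spine_block.
  have -> : down m u = u.+1.
    move: sp; rewrite /down /spine => /norP[/negPf -> /negPf ->].
    by case: eqP => // um; have := nsp 1 isT; lia.
  rewrite sp orbF; apply/idP/idP.
    case/or3P.
    + by rewrite /edges1; have := nsp 1 isT; lia.
    + by rewrite /edges2_new; have := nsp 2 isT; lia.
    + case/edges_hasP => i [i0 ir]; rewrite /edgesF.
      have := nsp i i0; have := nsp i.+2 isT; lia.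
  move=> /eqP ->; case: b br uE => [| [|i]] br uE.
  + by apply/or3P/Or31; rewrite /edges1; lia.
  + by apply/or3P/Or32; rewrite /edges2_new; lia.
  + apply/or3P/Or33/edges_hasP; exists i.+1; first by lia.
    by rewrite /edgesF; lia.
Qed.

Lemma down_neq_up m r u : 0 < m -> u < r * m + 2 -> down m u <> up m u.
Proof.
move=> m0 hu; rewrite /down /up.
by case: (u == 0); [lia | case: eqP; [lia | case: ifP; lia]].
Qed.

Lemma down_neq m u : 0 < m -> (u == down m u) = false.
Proof.
move=> m0; rewrite /down; have [->//|u0] := eqVneq u 0.
have [->//|um] := eqVneq u m.+1; case: ifP; lia.
Qed.

Lemma down_lt m r u : 0 < m -> 0 < r -> u < r * m + 2 -> down m u < r * m + 2.
Proof.
move=> m0 r0 hu; case: (vertexP m0 hu) => [->|->| [c c0 uE]| [b [ o [br om uE]]]].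
- by rewrite /down /=; lia.
- by rewrite /down /=; case: eqP; nia.
- rewrite uE down_spine //; last by case/andP: c0.
  by case: eqP; nia.
- have := spine_interior b om; rewrite -uE /spine /down => /norP[/negPf -> /negPf ->].
  by case: eqP; nia.
Qed.

(** The unknown determined by the equation of vertex u when (l - A) v = 0 is
    solved from the last vertex downwards: the equation of s_k yields v at
    s_(k-1), an interior equation yields its own unknown, and the redundant
    equation, that of s_(-1) = 1, is paired with the last vertex. *)
Definition pivot (m r u : nat) : nat :=
  if u == 1 then r * m + 1 else if spine m u then down m u else u.

Definition unpivot (m r w : nat) : nat :=
  if w == 1 then 0 else if w == 0 then m.+1 else if w == r * m + 1 then 1
  else if spine m w then w + m else w.

(** Unknowns are found in decreasing order of rank: that is the order of the
    vertices, except that s_0 = 0 comes before s_(-1) = 1. *)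
Definition pivot_rank (w : nat) : nat :=
  if w == 0 then 1 else if w == 1 then 0 else w.

Lemma pivotK m r u : 0 < m -> 0 < r -> u < r * m + 2 ->
  unpivot m r (pivot m r u) = u.
Proof.
move=> m0 r0 hu; case: (vertexP m0 hu) => [->|->| [c c0 uE]| [b [ o [br om uE]]]].
- by [].
- rewrite /pivot /= /unpivot eqxx.
  by case: eqP; [nia | case: eqP; nia].
- have cp : 0 < c by case/andP: c0.
  rewrite /pivot uE (_ : (c * m + 1 == 1) = false) ?spine_block
    ?down_spine //; last by nia.
  case: eqP => [->|c1]; first by rewrite /unpivot /=; lia.
  rewrite /unpivot spine_block //; last by lia.
  case: eqP; first by nia.
  by case: eqP; [nia | move=> _ _; case: eqP; nia].
- have sp := spine_interior b om; rewrite -uE in sp.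
  have u1 : (u == 1) = false by lia.
  have u0 : (u == 0) = false by lia.
  rewrite /pivot u1 sp /unpivot u1 u0 sp.
  by case: eqP => // ur; move: sp; rewrite ur spine_block.
Qed.

Lemma pivot_lt m r u : 0 < m -> 0 < r -> u < r * m + 2 ->
  pivot m r u < r * m + 2.
Proof.
move=> m0 r0 hu; rewrite /pivot; case: eqP => _; first by lia.
by case: ifP => // _; apply: down_lt.
Qed.

Lemma pivot_rank_id w : 1 < w -> pivot_rank w = w.
Proof. by case: w => [| [|w]]. Qed.

Lemma pivot_rank_lt m r u w : 0 < m -> 0 < r -> u < r * m + 2 -> u != 1 ->
  [|| w == u, w == down m u | spine m u && (w == up m u)] ->
  w = pivot m r u \/ pivot_rank (pivot m r u) < pivot_rank w.
Proof.
move=> m0 r0 hu /negPf u1; rewrite /pivot u1.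
case: (vertexP m0 hu) => [uE|uE| [c c0 uE]| [b [ o [br om uE]]]].
- rewrite uE /spine /down /up /pivot_rank /= => /or3P[] /eqP ->; by [right|left|right].
- by rewrite uE in u1.
- have cp : 0 < c by case/andP: c0.
  have -> : spine m u by rewrite uE spine_block.
  have dE := down_spine m0 cp; rewrite -uE in dE.
  have -> : up m u = u + m.+1 by rewrite /up; case: eqP; nia.
  have u2 : 1 < u by nia.
  have down_u : pivot_rank (down m u) < u.
    rewrite dE; have [c1|c1] := eqVneq c 1; first by [].
    by rewrite pivot_rank_id ?uE; nia.
  case/or3P => /eqP ->; [right | by left | right].
    by rewrite [X in _ < X]pivot_rank_id.
  by rewrite [X in _ < X]pivot_rank_id; lia.
- have sp := spine_interior b om; rewrite -uE in sp; rewrite sp orbF.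
  have dE : down m u = u.+1.
    move: (sp); rewrite /down /spine => /norP[/negPf -> /negPf ->].
    by case: eqP => // um; move: sp;
      rewrite um -[m.+1]addn1 -[m in m + 1]mul1n spine_block.
  rewrite dE => /orP[] /eqP ->; [by left | right].
  by rewrite !pivot_rank_id; lia.
Qed.

Local Open Scope classical_set_scope.
Local Open Scope card_scope.
Local Open Scope complex_scope.
Local Open Scope ring_scope.

(** * The polynomials J_k *)

(** The coefficient of X^j is the number of j-subsets of k - 2 consecutive
    integers whose elements differ pairwise by at least 3. *)
Fixpoint gap_poly (K : comNzRingType) (k : nat) : {poly K} :=
  match k with
  | S ((S (S k')) as k'') => gap_poly K k'' + 'X * gap_poly K k'
  | _ => 1
  end.

Arguments gap_poly : simpl never.

Lemma gap_polyS (K : comNzRingType) k :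
  gap_poly K k.+3 = gap_poly K k.+2 + 'X * gap_poly K k.
Proof. by []. Qed.

Lemma nat_ind3 (P : nat -> Prop) :
  P 0%N -> P 1%N -> P 2 -> (forall k, P k -> P k.+1 -> P k.+2 -> P k.+3) ->
  forall k, P k.
Proof.
move=> P0 P1 P2 PS k; suff [] : [/\ P k, P k.+1 & P k.+2] by [].
by elim: k => [|k [H0 H1 H2]]; split=> //; apply: PS.
Qed.

Lemma map_gap_poly (K L : comNzRingType) (f : {rmorphism K -> L}) k :
  map_poly f (gap_poly K k) = gap_poly L k.
Proof.
elim/nat_ind3: k => [||| k IH0 _ IH2]; rewrite ?rmorph1 //.
by rewrite !gap_polyS rmorphD rmorphM /= IH0 IH2 map_polyX.
Qed.

Lemma horner_gap_polyS (K : comNzRingType) k x :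
  (gap_poly K k.+3).[x] = (gap_poly K k.+2).[x] + x * (gap_poly K k).[x].
Proof. by rewrite gap_polyS hornerD hornerM hornerX. Qed.

Lemma horner_gap_poly0 (K : comNzRingType) k : (gap_poly K k).[0] = 1.
Proof.
elim/nat_ind3: k => [||| k _ _ IH]; rewrite ?hornerC //.
by rewrite horner_gap_polyS IH mul0r addr0.
Qed.

Lemma coef_gap_poly_ge0 (R : numDomainType) k i : 0 <= (gap_poly R k)`_i.
Proof.
elim/nat_ind3: k i => [i|i|i| k IH0 _ IH2 i]; try by rewrite coef1 ler0n.
rewrite gap_polyS coefD coefXM addr_ge0 //.
by case: ifP.
Qed.

Lemma divS3 k : (k.+3 %/ 3 = (k %/ 3).+1)%N.
Proof. by rewrite -addn3 divnDr // addn1. Qed.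

Lemma coef_gap_poly_gt0 (R : numDomainType) k :
  0 < (gap_poly R k)`_(k %/ 3).
Proof.
elim/nat_ind3: k => [||| k IH _ _]; try by rewrite coef1 ltr01.
by rewrite gap_polyS divS3 coefD coefXM ltr_wpDl ?coef_gap_poly_ge0.
Qed.

Lemma size_gap_poly (R : numDomainType) k :
  size (gap_poly R k) = (k %/ 3).+1.
Proof.
apply/eqP; rewrite eqn_leq; apply/andP; split; last first.
  rewrite ltnNge; apply: contraTN (coef_gap_poly_gt0 R k) => h.
  by rewrite nth_default // ltxx.
elim/nat_ind3: k => [||| k IH0 _ IH2]; rewrite ?size_poly1 //.
rewrite gap_polyS (leq_trans (size_polyD _ _)) // geq_max divS3.
rewrite mulrC (leq_trans (size_polyMleq _ _)) ?size_polyX ?addn2 //= ?ltnS //.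
rewrite andbT (leq_trans IH2) // ltnS -divS3 leq_div2r //.
Qed.

(** The constant 4/27 is where the induction J_(k+1) >= q J_k closes: it needs
    x >= - q^2 (1 - q), and q = 2/3 maximises q^2 (1 - q). *)
Lemma gap_poly_gt0 (R : realFieldType) k (x : R) :
  - (4 / 27) <= x -> 0 < (gap_poly R k).[x].
Proof.
move=> hx.
suff: [/\ 0 < (gap_poly R k).[x],
          2 / 3 * (gap_poly R k).[x] <= (gap_poly R k.+1).[x] &
          2 / 3 * (gap_poly R k.+1).[x] <= (gap_poly R k.+2).[x]] by case.
elim: k => [|k]; first by rewrite !hornerC; split; lra.
rewrite horner_gap_polyS; set a := _.[x]; set b := _.[x]; set c := _.[x].
by move=> [a0 ab bc]; split=> //; nra.
Qed.

(** * The roots of J_k are real and simple *)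

(** Pairs stand for the numbers a.1 + a.2 w where w is a square root of
    - kap / q; [mulz] is multiplication by p + q w.  For kap = q this is the
    complex plane, for kap = 0 and q = 1 it is the ring of dual numbers. *)
Section Sector.
Variables (R : realFieldType) (p q kap : R).
Implicit Types a b c : R * R.

Definition bracket a b := a.1 * b.2 - a.2 * b.1.

Definition mulz a : R * R := (p * a.1 - kap * a.2, q * a.1 + p * a.2).

(** With bracket the area form: a, b, c, z a follow each other
    counterclockwise within a half plane. *)
Definition sector a b c :=
  [/\ 0 < bracket a b, 0 < bracket b c, 0 < bracket c (mulz a)
    & 0 < bracket b (mulz a)].

Hypotheses (q0 : 0 < q) (kap0 : 0 <= kap) (det0 : 0 < p ^+ 2 + q * kap).

(** The new vector c + z a lies between c and z a, so only the position of c
    before z b has to be checked. *)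
Lemma sector_step a b c : sector a b c ->
  sector b c (c.1 + (mulz a).1, c.2 + (mulz a).2).
Proof.
case: a b c => a1 a2 [b1 b2] [c1 c2]; rewrite /sector /bracket /mulz /=.
move=> [hab hbc hca hba].
have hcb : 0 < c1 * (q * b1 + p * b2) - c2 * (p * b1 - kap * b2).
  (* Pluecker's relation between the brackets of b, c, z a and z b. *)
  rewrite -(pmulr_lgt0 _ hba).
  have -> : (c1 * (q * b1 + p * b2) - c2 * (p * b1 - kap * b2)) *
      (b1 * (q * a1 + p * a2) - b2 * (p * a1 - kap * a2)) =
    (b1 * c2 - b2 * c1) * ((p ^+ 2 + q * kap) * (a1 * b2 - a2 * b1)) +
    (q * b1 ^+ 2 + kap * b2 ^+ 2) *
      (c1 * (q * a1 + p * a2) - c2 * (p * a1 - kap * a2)) by ring.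
  apply: ltr_pwDl; first by rewrite !mulr_gt0.
  apply: mulr_ge0 (ltW hca).
  by apply: addr_ge0; apply: mulr_ge0; rewrite ?sqr_ge0 ?(ltW q0).
split=> //.
- by have -> : forall X Y, c1 * (c2 + Y) - c2 * (c1 + X) = c1 * Y - c2 * X
    by move=> X Y; ring.
- have -> : (c1 + (p * a1 - kap * a2)) * (q * b1 + p * b2) -
     (c2 + (q * a1 + p * a2)) * (p * b1 - kap * b2) =
   (c1 * (q * b1 + p * b2) - c2 * (p * b1 - kap * b2)) +
   (p ^+ 2 + q * kap) * (a1 * b2 - a2 * b1) by ring.
  by rewrite addr_gt0 // mulr_gt0.
Qed.

(** The three equal initial vectors are degenerate: the strict configuration is
    first reached by 1 + z, 1 + 2 z, 1 + 3 z. *)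
Lemma sector_rec (s : nat -> R * R) :
  s 0%N = (1, 0) -> s 1%N = (1, 0) -> s 2 = (1, 0) ->
  (forall k, s k.+3 = ((s k.+2).1 + (mulz (s k)).1, (s k.+2).2 + (mulz (s k)).2)) ->
  forall k, s k <> (0, 0).
Proof.
move=> s0 s1 s2 sS.
have step k : sector (s k) (s k.+1) (s k.+2) ->
    sector (s k.+1) (s k.+2) (s k.+3) by rewrite sS; apply: sector_step.
have base : sector (s 3) (s 4) (s 5).
  have qk : 0 <= q * kap by rewrite mulr_ge0 // ltW.
  have h t : 2 <= t -> 0 < q * (1 + 2 * p + t * (p ^+ 2 + q * kap)).
    by move=> ht; rewrite mulr_gt0 //; have := sqr_ge0 (2 * p + 1); nra.
  rewrite !sS s0 s1 s2 /sector /bracket /mulz /=; split.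
  - by rewrite (_ : _ - _ = q); [|ring].
  - by rewrite (_ : _ - _ = q); [|ring].
  - by rewrite (_ : _ - _ = q * (1 + 2 * p + 3 * (p ^+ 2 + q * kap)));
      [apply: h; lra | ring].
  - by rewrite (_ : _ - _ = q * (1 + 2 * p + 2 * (p ^+ 2 + q * kap)));
      [apply: h; lra | ring].
have all k : sector (s k.+3) (s k.+4) (s k.+4.+1) by elim: k => // k /step.
elim/nat_ind3=> [||| k _ _ _ sk]; rewrite ?s0 ?s1 ?s2;
  try by case=> /eqP; rewrite oner_eq0.
by have [] := all k; rewrite sk /bracket /= !mul0r subrr ltxx.
Qed.

End Sector.

(** The factor e turns a point of the lower half plane into its conjugate. *)
Lemma gap_poly_real_root (R : rcfType) k (z : R[i]) :
  root (gap_poly R[i] k) z -> complex.Im z = 0.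
Proof.
case: z => p q /rootP Jz /=; apply/eqP/negPn/negP => q0.
pose e : R := Num.sg q.
have e2 : e * e = 1 by rewrite -expr2 sqr_sg q0.
have eq0 : 0 < e * q by rewrite -normrEsg normr_gt0.
pose s j := (complex.Re (gap_poly R[i] j).[p +i* q],
             e * complex.Im (gap_poly R[i] j).[p +i* q]).
apply: (@sector_rec R p (e * q) (e * q) eq0 (ltW eq0) _ s _ _ _ _ k);
  rewrite /s ?hornerC ?mulr0 //.
- by have := sqr_ge0 p; have := mulr_gt0 eq0 eq0; lra.
- move=> j; rewrite horner_gap_polyS /mulz /=.
  case: _.[_] => a b /=; case: _.[_] => c d /=; congr pair; last by ring.
  by rewrite mulrACA e2; ring.
- by rewrite Jz /= mulr0.
Qed.

(** The sector argument at the dual number x + eps, whose norm x^2 must not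
    vanish. *)
Lemma gap_poly_simple_root (R : rcfType) k (x : R) : x != 0 ->
  root (gap_poly R k) x -> ~~ root (gap_poly R k)^`() x.
Proof.
move=> x0 /rootP Jx; apply/negP => /rootP dJx.
pose s j := ((gap_poly R j).[x], (gap_poly R j)^`().[x]).
apply: (@sector_rec R x 1 0 ltr01 (lexx 0) _ s _ _ _ _ k);
  rewrite /s ?derivC ?hornerC //.
- by rewrite mulr0 addr0 exprn_even_gt0.
- move=> j; rewrite horner_gap_polyS gap_polyS derivD derivM derivX mul1r.
  by rewrite !hornerE /mulz /= subr0.
- by rewrite Jx dJx.
Qed.

Lemma gap_poly_separable (R : rcfType) k : separable_poly (gap_poly R[i] k).
Proof.
rewrite unlock /coprimep; apply/negPn/negP => /closed_rootP [z].
rewrite root_gcd => /andP[Jz dJz].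
have zE : z = (complex.Re z)%:C.
  by case: z Jz {dJz} => p q /gap_poly_real_root /= ->.
move: Jz dJz; rewrite -(map_gap_poly (real_complex R)) deriv_map zE !fmorph_root.
move=> Jx; apply/negP; apply: gap_poly_simple_root => //.
by apply: contraTneq Jx => ->; rewrite /root horner_gap_poly0 oner_eq0.
Qed.

(** The u are the - 1 / z for z a root; no leading coefficient appears because
    the value at 0 is 1. *)
Lemma gap_poly_factor (R : rcfType) k : exists us : seq R,
  [/\ uniq us, size us = (k %/ 3)%N, {in us, forall u, 0 < u < 27 / 4} &
      gap_poly R[i] k = \prod_(u <- us) (1 + u%:C *: 'X)].
Proof.
set J := gap_poly R[i] k.
have [zs Jzs] := closed_field_poly_normal J.
have J0 : J != 0 by rewrite separable_poly_neq0 ?gap_poly_separable.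
have lJ : lead_coef J != 0 by rewrite lead_coef_eq0.
have zs_root z : z \in zs -> root J z.
  by rewrite Jzs rootZ // root_prod_XsubC.
have zsE z : z \in zs -> z = (complex.Re z)%:C /\ complex.Re z < - (4 / 27).
  move=> /zs_root Jz; have := gap_poly_real_root Jz.
  case: z Jz => p q Jz /= q0; move: Jz; rewrite {}q0 => Jp; split=> //.
  rewrite ltNge; apply/negP => /(gap_poly_gt0 k).
  move: Jp; rewrite /J -(map_gap_poly (real_complex R)) fmorph_root => /rootP ->.
  by rewrite ltxx.
have uzs : uniq zs.
  rewrite -separable_prod_XsubC.
  have := gap_poly_separable R k; rewrite -/J Jzs.
  by rewrite -mul_polyC separable_mul => /and3P[].
exists [seq - (complex.Re z)^-1 | z <- zs]; split.
- rewrite map_inj_in_uniq // => x y /zsE[xE _] /zsE[yE _] /oppr_inj /invr_inj h.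
  by rewrite xE yE h.
- rewrite size_map; have := congr1 (size \o @polyseq _) Jzs.
  by rewrite /= size_scale // size_prod_XsubC /J size_gap_poly => -[].
- move=> _ /mapP[z /zsE[_ h] ->]; set x := complex.Re z in h *.
  rewrite -invrN; have y0 : 4 / 27 < - x by lra.
  rewrite invr_gt0 invf_plt ?posrE; [|lra|lra].
  by rewrite (_ : (27 / 4)^-1 = 4 / 27); [apply/andP; split; lra | field].
- rewrite big_map; have := congr1 (fun p => p.[0]) Jzs.
  rewrite /= horner_gap_poly0 hornerZ horner_prod => h1.
  have -> : J = (lead_coef J)%:P * \prod_(z <- zs) ((('X - z%:P).[0])%:P *
      (1 + (- (complex.Re z)^-1)%:C *: 'X)).
    rewrite {1}Jzs -mul_polyC; congr (_ * _); apply: eq_big_seq => z /zsE[zE h].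
    rewrite hornerXsubC sub0r {1 2}zE; set x := complex.Re z in h *.
    have x0 : x != 0.
      by rewrite lt_eqF // (lt_trans h) // oppr_lt0 divr_gt0 // ltr0n.
    rewrite mulrDr mulr1 -mul_polyC mulrA -polyCM.
    rewrite -(rmorphN (real_complex R)).
    rewrite -(rmorphM (real_complex R)) /= mulrNN.
    by rewrite divff // polyC1 mul1r addrC rmorphN polyCN.
  rewrite big_split /= mulrA -(rmorph_prod polyC) /= -polyCM -h1 polyC1 mul1r.
  by [].
Qed.

(** * The determinant of l - A *)

(** In the Leibniz expansion, a permutation t that contributes satisfies
    rho (s u) <= rho (t u) for every u; the sums over u of both sides agree, so
    equality holds everywhere and t = s. *)
Lemma det_pivots (K : comNzRingType) N (B : 'M[K]_N) (s : 'S_N)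
    (rho : 'I_N -> nat) :
  (forall u w, B u w != 0 -> w = s u \/ (rho (s u) < rho w)%N) ->
  \det B = (-1) ^+ s * \prod_u B u (s u).
Proof.
move=> Bs; rewrite /determinant (bigD1 s) //= [X in _ + X]big1 ?addr0 // => t ts.
have [/existsP[u /eqP Btu]|/existsPn Bt] := boolP [exists u, B u (t u) == 0].
  by rewrite (bigD1 u) //= Btu mul0r mulr0.
have rle u : (rho (s u) <= rho (t u))%N by case: (Bs u (t u)) => [||/ltnW] // ->.
have rsum : (\sum_u rho (s u) = \sum_u rho (t u))%N.
  transitivity (\sum_u rho u)%N; last exact: (reindex_inj (@perm_inj _ t)).
  by apply/esym/(reindex_inj (@perm_inj _ s)).
case/eqP: ts; apply/permP => u; case: (Bs u (t u)) => // rlt.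
suff : (\sum_u rho (s u) < \sum_u rho (t u))%N by rewrite rsum ltnn.
by rewrite (bigD1 u) //= [ltnRHS](bigD1 u) //= -addSn leq_add // leq_sum.
Qed.

Section Weights.
Variables (K : fieldType) (m r : nat) (l : K).
Hypothesis m0 : (0 < m)%N.

Let J k := (gap_poly K k).[- (l ^+ m.+2)^-1].

(** The solution normalised to 1 at the last vertex s_r: its value at s_k is
    l^(r-k) J_(r-k), and it is divided by l at each step backwards from s_k along
    the path leading to s_k. *)
Definition weight (u : nat) : K :=
  let k := (r.-1 - (u - 2) %/ m)%N in
  if u == 0%N then l ^+ r * J r else if u == 1%N then l ^+ r.+1 * J r.+1
  else l ^+ k * J k / l ^+ (m.-1 - (u - 2) %% m).

Arguments weight : simpl never.

Lemma weight_block b o : (o < m)%N ->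
  weight (b * m + 2 + o) = l ^+ (r.-1 - b) * J (r.-1 - b) / l ^+ (m.-1 - o).
Proof.
move=> om; rewrite /weight; do 2 (case: eqP; first by lia); move=> _ _.
have -> : (b * m + 2 + o - 2 = b * m + o)%N by lia.
by rewrite divnMDl // modnMDl divn_small // modn_small // addn0.
Qed.

Lemma weight_spine c : (0 < c)%N ->
  weight (c * m + 1) = l ^+ (r - c) * J (r - c).
Proof.
case: c => // b _; have -> : (b.+1 * m + 1 = b * m + 2 + m.-1)%N by lia.
rewrite weight_block ?prednK // subnn expr0 divr1.
by have -> : (r.-1 - b = r - b.+1)%N by lia.
Qed.

Hypothesis l0 : l != 0.

(** The recurrence of the J_k at X = - l^-n, in the form taken by the equation
    of a spine vertex; the case distinction is that of the end of the strip. *)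
Lemma weight_rec c :
  l * (l ^+ c * J c) - l ^+ c.+1 * J c.+1 =
  if (1 < c)%N then l ^+ (c - 2) * J (c - 2) / l ^+ m.-1 else 0.
Proof.
case: c => [| [|c]]; rewrite /J ?hornerC ?mulr1 ?exprS ?expr0 ?mulr1 ?subrr //.
rewrite horner_gap_polyS !subSS subn0 /= -(prednK m0) /= !exprS.
by field; rewrite l0 expf_neq0.
Qed.

Lemma weight_row u : (0 < r)%N -> (u < r * m + 2)%N ->
  l * weight u - weight (down m u)
    - (if spine m u && (up m u < r * m + 2)%N then weight (up m u) else 0) =
  if u == 1%N then l ^+ r.+2 * J r.+2 else 0.
Proof.
move=> r0 hu; case: (vertexP m0 hu) => [->|->| [c c0 uE]| [b [ o [br om uE]]]].
- rewrite /spine /down /up /= {1 2}/weight /= weight_rec.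
  have -> : (m.+2 < r * m + 2)%N = (1 < r)%N by nia.
  case: ifP => r1; last by rewrite subr0.
  rewrite (_ : m.+2 = 1 * m + 2 + 0)%N; last by lia.
  by rewrite weight_block // subn0 (_ : r - 2 = r.-1 - 1)%N ?subrr //; lia.
- have -> : down m 1 = 2 by rewrite /down /=; case: (m) m0.
  rewrite /spine /= subr0.
  have -> : weight 2 = l ^+ r.-1 * J r.-1 / l ^+ m.-1.
    by have := @weight_block 0 0 m0; rewrite mul0n !subn0.
  rewrite {1}/weight /=.
  have := weight_rec r.+1; rewrite /= ltnS r0 => h.
  rewrite -[RHS](subKr (l * (l ^+ r.+1 * J r.+1))) h.
  by rewrite subSS subn1.
- have cp : (0 < c)%N by case/andP: c0.
  have cr : (c <= r)%N by case/andP: c0.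
  have -> : (u == 1%N) = false by nia.
  have -> : weight (down m u) = l ^+ (r - c).+1 * J (r - c).+1.
    rewrite uE down_spine //; case: eqP => [->|c1].
      by rewrite /weight /= subn1 prednK.
    have -> : ((r - c).+1 = r - c.-1)%N by lia.
    by rewrite weight_spine //; lia.
  rewrite {1}uE weight_spine // weight_rec uE spine_block //=.
  have -> : up m (c * m + 1) = (c.+1 * m + 2 + 0)%N by rewrite /up; case: eqP; lia.
  have -> : (c.+1 * m + 2 + 0 < r * m + 2)%N = (1 < r - c)%N by nia.
  case: ifP => _; last by rewrite subr0.
  by rewrite weight_block // subn0 (_ : r - c - 2 = r.-1 - c.+1)%N ?subrr //; lia.
- have -> : (u == 1%N) = false by lia.
  have sp := spine_interior b om; rewrite -uE in sp; rewrite sp subr0.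
  have -> : down m u = (b * m + 2 + o.+1)%N.
    move: (sp); rewrite /down /spine => /norP[/negPf -> /negPf ->].
    case: eqP => [um|]; last by lia.
    by move: sp; rewrite um -[m.+1]addn1 -[m in (m + 1)%N]mul1n spine_block.
  rewrite uE !weight_block //; last by lia.
  rewrite (_ : m.-1 - o = (m.-1 - o.+1).+1)%N; last by lia.
  by rewrite exprS; field; rewrite l0 expf_neq0.
Qed.

End Weights.

Lemma cofactor_row_delta (K : comNzRingType) N (M : 'M[K]_N) (i j : 'I_N) :
  cofactor M i j = \det (\matrix_(u, w) if u == i then (w == j)%:R else M u w).
Proof.
set B := (X in \det X).
rewrite (expand_det_row B i) (bigD1 j) //= big1 ?addr0; last first.
  by move=> w /negPf wj; rewrite mxE eqxx wj mul0r.
rewrite mxE !eqxx mul1r /cofactor; congr (_ * \det _).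
by apply/matrixP => u w; rewrite !mxE eq_sym (negPf (neq_lift _ _)).
Qed.

Lemma sum_ord_pred1 (K : nzRingType) N (d : nat) (F : nat -> K) :
  \sum_(w < N) (w == d :> nat)%:R * F w = if (d < N)%N then F d else 0.
Proof.
case: ifP => dN.
  rewrite (bigD1 (Ordinal dN)) //= eqxx mul1r big1 ?addr0 // => w.
  by rewrite -val_eqE /= => /negPf ->; rewrite mul0r.
rewrite big1 // => w _; case: eqP => [wd|]; last by rewrite mul0r.
by move: (ltn_ord w); rewrite wd dN.
Qed.

Section Det.
Variables (K : fieldType) (m r : nat).
Hypotheses (m0 : (0 < m)%N) (r0 : (0 < r)%N).
Let N := num_vertices m.+2 r.
Let A : 'M[K]_N := map_mx intr (adj m.+2 r).

Let ltN (u : 'I_N) : (u < r * m + 2)%N.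
Proof. by rewrite -num_verticesE ltn_ord. Qed.

Let adjE u w : A u w =
  (w == down m u :> nat)%:R + (if spine m u then (w == up m u :> nat)%:R else 0).
Proof.
rewrite !mxE edgesE //; case: eqP => [wd|_] /=; case: (spine m u) => /=.
- have -> : (w == up m u :> nat) = false; last by rewrite addr0.
  by rewrite wd; apply/eqP/(down_neq_up m0 (ltN u)).
- by rewrite addr0.
- by rewrite add0r; case: (_ == _).
- by rewrite addr0.
Qed.

Let charE (l : K) u w : (l%:M - A) u w = (w == u :> nat)%:R * l
  - ((w == down m u :> nat)%:R + (if spine m u then (w == up m u :> nat)%:R else 0)).
Proof.
rewrite -adjE mxE [X in X + _]mxE [X in _ + X]mxE eq_sym.
by rewrite -val_eqE mulr_natl.
Qed.

Fact pivot_subproof (u : 'I_N) : (pivot m r u < N)%N.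
Proof.
by move: (ltN u); move: (val u) => k; rewrite /N num_verticesE; apply: pivot_lt.
Qed.

Let pivot_ord u : 'I_N := Ordinal (pivot_subproof u).

Let pivot_inj : injective pivot_ord.
Proof.
move=> u w /(congr1 val) /= h; apply: val_inj.
by rewrite /= -(pivotK m0 r0 (ltN u)) h pivotK.
Qed.

Fact second_subproof : (1 < N)%N.
Proof. by rewrite /N num_verticesE addn2. Qed.

Fact last_subproof : (r * m + 1 < N)%N.
Proof. by rewrite /N num_verticesE addn1 addn2. Qed.

Let second := Ordinal second_subproof.
Let last := Ordinal last_subproof.

(** The weights satisfy every equation of (l - A) v = 0 except that of s_(-1). *)
Lemma charmx_mul_weight (l : K) : l != 0 ->
  (l%:M - A) *m (\col_u weight m r l u) =
  (l ^+ r.+2 * (gap_poly K r.+2).[- (l ^+ m.+2)^-1]) *: delta_mx second 0.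
Proof.
move=> l0; apply/matrixP => u j; rewrite !mxE ord1 eqxx andbT.
rewrite -val_eqE /=.
have -> : l ^+ r.+2 * (gap_poly K r.+2).[- (l ^+ m.+2)^-1] * (u == 1%N :> nat)%:R
  = if u == 1%N :> nat then l ^+ r.+2 * (gap_poly K r.+2).[- (l ^+ m.+2)^-1] else 0.
  by case: ifP => _; rewrite ?mulr1 ?mulr0.
rewrite -(weight_row m0 l0 r0 (ltN u)).
have dN : (down m u < N)%N.
  by move: (ltN u); move: (val u) => k; rewrite /N num_verticesE; apply: down_lt.
transitivity (\sum_(w < N) ((w == u :> nat)%:R * (l * weight m r l w)
   - (w == down m u :> nat)%:R * weight m r l w
   - (w == up m u :> nat)%:R * (if spine m u then weight m r l w else 0))).
  apply: eq_bigr => w _; rewrite charE [(\col__ _) _ _]mxE; case: (spine m u); ring.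
rewrite !sumrB (sum_ord_pred1 _ _ (fun w => l * weight m r l w)).
rewrite (sum_ord_pred1 _ _ (weight m r l)).
rewrite (sum_ord_pred1 _ _ (fun w => if spine m u then weight m r l w else 0)).
rewrite ltn_ord dN; congr (_ - _ - _).
by rewrite -num_verticesE; case: (spine m u) => //=; case: ifP.
Qed.

(** Row s_(-1), the only nonzero equation of [charmx_mul_weight], is replaced by
    the equation of the last unknown; then every other equation is solved by its
    pivot, which is -1 on the spine and l on the interior of the paths. *)
Lemma cofactor_second_last : exists a c, forall l : K,
  cofactor (l%:M - A) second last = (-1) ^+ a * l ^+ c.
Proof.
pose ps := perm pivot_inj.
exists (ps + \sum_(u < N) ((u != second) && spine m u))%N,
  (\sum_(u < N) ((u != second) && ~~ spine m u))%N => l.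
rewrite cofactor_row_delta (@det_pivots _ _ _ ps pivot_rank); last first.
  move=> u w; rewrite mxE /ps permE.
  have [->|u1] := eqVneq u second.
    have [->|] := eqVneq w last; last by rewrite eqxx.
    by move=> _; left; apply: val_inj; rewrite /= /pivot.
  move=> h; case: (@pivot_rank_lt m r u w m0 r0 (ltN u)) => //=.
    move: h; apply: contraR => /norP[wu /norP[wd wp]].
    rewrite charE (negPf wu) (negPf wd); apply/eqP.
    by move: wp; case: (spine m u) => /= [/negPf ->|_]; rewrite /= ?mulr0n; ring.
  by move=> wE; left; apply: val_inj.
  by right.
rewrite exprD -mulrA -!prodrXr -big_split /=; congr (_ * _).
apply: eq_bigr => u _; rewrite mxE /ps permE.
case: eqP => [->|/eqP u1] /=.
  by rewrite -val_eqE /= /pivot /= eqxx !expr0 mulr1.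
have u1' : (u == 1%N :> nat) = false by apply/negbTE; move: u1; rewrite -val_eqE.
rewrite charE /= /pivot u1' /=; case: ifP => sp /=.
  rewrite eqxx expr1 expr0 mulr1.
  rewrite eq_sym (down_neq _ m0).
  have -> : (down m u == up m u) = false by apply/eqP/(down_neq_up m0 (ltN u)).
  by rewrite /= ?mulr0n ?mulr1n; ring.
rewrite eqxx expr1 expr0 mul1r.
rewrite (down_neq _ m0).
by rewrite /= ?mulr0n ?mulr1n; ring.
Qed.

(** Cramer's rule; the sign and the power do not depend on l, which is what lets
    a comparison of polynomials determine them. *)
Theorem det_adj : exists a c, forall l : K, l != 0 ->
  \det (l%:M - A) = (-1) ^+ a * l ^+ c * (gap_poly K r.+2).[- (l ^+ m.+2)^-1].
Proof.
have [a [c cof]] := cofactor_second_last.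
exists a, (c + r.+2)%N => l l0.
have := congr1 (mulmx (\adj (l%:M - A))) (charmx_mul_weight l0).
rewrite mulmxA mul_adj_mx mul_scalar_mx -scalemxAr.
move=> /matrixP /(_ last 0); rewrite !mxE weight_spine // subnn.
rewrite expr0 mul1r hornerC mulr1 => ->.
rewrite (bigD1 second) //= big1 ?addr0; last first.
  by move=> w /negPf w2; rewrite [delta_mx _ _ _ _]mxE w2 mulr0.
rewrite [delta_mx _ _ _ _]mxE !eqxx mulr1 mxE cof exprD; ring.
Qed.

End Det.

(** * The characteristic polynomial *)

Lemma horner_inj_nonzero (K : numFieldType) (p q : {poly K}) :
  (forall l, l != 0 -> p.[l] = q.[l]) -> p = q.
Proof.
move=> pq; apply/eqP; rewrite -subr_eq0; apply/eqP.
apply: (@roots_geq_poly_eq0 _ _ [seq i%:R | i <- iota 1 (size (p - q))]).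
- rewrite all_map; apply/allP => i; rewrite mem_iota => /andP[i0 _].
  by rewrite /= rootE !hornerE pq ?subrr // pnatr_eq0 -lt0n.
- by rewrite map_inj_uniq ?iota_uniq // => i j /eqP; rewrite eqr_nat => /eqP.
- by rewrite size_map size_iota.
Qed.

Lemma horner_char_poly (K : comNzRingType) N (A : 'M[K]_N) l :
  (char_poly A).[l] = \det (l%:M - A).
Proof.
rewrite -[LHS]/(horner_eval l (char_poly A)) -det_map_mx; congr (\det _).
by apply/matrixP => i j; rewrite !mxE /= /horner_eval;
  rewrite hornerD hornerN hornerMn hornerX hornerC.
Qed.

Section CharPoly.
Variables (R : realType) (m r : nat) (us : seq R).
Hypotheses (m0 : (0 < m)%N) (r0 : (0 < r)%N).
Hypotheses (size_us : size us = (r.+2 %/ 3)%N)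
  (gapE : gap_poly R[i] r.+2 = \prod_(u <- us) (1 + u%:C *: 'X)).

Let n := m.+2.
Let N := num_vertices n r.
Let p := char_poly (adjC R n r).

Let prodXn := \prod_(u <- us) ('X^n - (u%:C)%:P).

Let prodXn_monic : prodXn \is monic.
Proof. by apply: monic_prod => u _; apply: monicXnsubC. Qed.

Let nsN : (n * size us <= N)%N.
Proof.
rewrite /N num_verticesE size_us /n.
(* n |us| = (m - 1) |us| + 3 |us|, with |us| <= r and 3 |us| <= r + 2. *)
have := leq_trunc_div r.+2 3; nia.
Qed.

Let size_prodXn : size prodXn = (n * size us).+1.
Proof.
rewrite /prodXn; elim: us => [|u s IH]; first by rewrite big_nil size_poly1 muln0.
rewrite big_cons size_monicM ?monicXnsubC //; last first.
  by rewrite -size_poly_eq0 IH.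
by rewrite IH size_XnsubC // mulnS addSn addnS.
Qed.

(** The identity of [det_adj] is cleared of denominators with X^(n |us|); both
    sides being monic up to sign, the unknown sign is 1 and the unknown exponent
    is the number of vertices. *)
Lemma char_poly_adj : char_poly (adjC R m.+2 r) =
  'X^(num_vertices m.+2 r - m.+2 * size us) *
  \prod_(u <- us) ('X^(m.+2) - (u%:C)%:P).
Proof.
rewrite -/p -/n -/N -/prodXn.
have [a [c detE]] := @det_adj R[i] m r m0 r0.
have e1 : p * 'X^(n * size us) = ((-1) ^+ a)%:P * ('X^c * prodXn).
  apply: horner_inj_nonzero => l l0.
  rewrite !hornerM horner_char_poly detE // gapE hornerC !hornerXn -!mulrA.
  congr (_ * (_ * _)).
  rewrite horner_prod /prodXn horner_prod; elim: us => [|u s IH].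
    by rewrite !big_nil muln0 expr0 mulr1.
  rewrite !big_cons /= mulnS exprD mulrACA IH; congr (_ * _).
  by rewrite !hornerD hornerN !hornerC hornerZ hornerX hornerXn; field; rewrite expf_neq0.
have pmon : p \is monic by apply: char_poly_monic.
have a1 : (-1) ^+ a = 1 :> R[i].
  have := congr1 lead_coef e1.
  rewrite !lead_coefM lead_coefC !lead_coefXn (monicP pmon) (monicP prodXn_monic).
  by rewrite !mulr1 => <-.
move: e1; rewrite a1 mul1r => e1.
have cN : c = N.
  have := congr1 (size \o @polyseq _) e1; rewrite /= !size_monicM ?monic_neq0 ?monicXn //.
  by rewrite size_char_poly size_prodXn !size_polyXn; lia.
apply: (@mulIf _ 'X^(n * size us)); first by rewrite monic_neq0 ?monicXn.
by rewrite e1 cN mulrAC -exprD subnK.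
Qed.

End CharPoly.

(** * Regular polygons *)

Section Trig.
Variable R : realType.
Implicit Types t : R.

Lemma expiD t1 t2 : expi (t1 + t2) = expi t1 * expi t2.
Proof.
rewrite /expi cosD sinD; simpc.
by rewrite [X in _ +i* X]addrC [X in X + _]mulrC.
Qed.

Lemma expiX t j : expi t ^+ j = expi (t *+ j).
Proof.
elim: j => [|j IH]; first by rewrite expr0 mulr0n /expi cos0 sin0.
by rewrite exprS IH mulrS expiD.
Qed.

Lemma expi_neq1 t : 0 < t < 2 * pi -> expi t != 1.
Proof.
move=> /andP[t0 tpi]; apply/eqP => -[] ct _.
have s0 : 0 < sin (t / 2) by apply: sin_gt0_pi; lra.
have := cosD (t / 2) (t / 2); rewrite -splitr ct.
have := cos2Dsin2 (t / 2); nra.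
Qed.

Lemma expi_prim_root n : (0 < n)%N -> n.-primitive_root (expi (2 * pi / n%:R : R)).
Proof.
move=> n0; have nR0 : 0 < n%:R :> R by rewrite ltr0n.
apply/andP; split=> //; apply/forallP => -[j jn] /=; rewrite unity_rootE expiX.
have -> : 2 * pi / n%:R *+ j.+1 = 2 * pi * (j.+1%:R / n%:R) :> R.
  by rewrite -mulr_natr; ring.
case: (j.+1 =P n) => [->|jn'].
  by rewrite divff ?(gt_eqF nR0) // mulr1 [2 * _]mulrC mulr_natr
    /expi cos2pi sin2pi eqxx.
rewrite eqbF_neg expi_neq1 //; have := pi_gt0 R => p0.
rewrite !mulr_gt0 ?invr_gt0 ?ltr0n //= -[ltRHS]mulr1 ltr_pM2l ?mulr_gt0 //.
by rewrite ltr_pdivrMr // mul1r ltr_nat ltn_neqAle jn andbT; apply/eqP.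
Qed.

(** A regular n-gon is the set of all n-th roots of a nonzero number, because
    exp (2 i pi / n) is a primitive n-th root of unity. *)
Lemma regular_ngonP n (P : set R[i]) : (0 < n)%N ->
  regular_ngon n P <-> exists2 l : R[i], l != 0 & P = [set z | z ^+ n = l ^+ n].
Proof.
move=> n0; have prim := expi_prim_root n0.
have ngonE (l : R[i]) : l != 0 ->
    [set l * expi (2 * pi * j%:R / n%:R) | j in `I_n] = [set z | z ^+ n = l ^+ n].
  move=> l0; have powE j : expi (2 * pi * j%:R / n%:R) = expi (2 * pi / n%:R : R) ^+ j.
    by rewrite expiX; congr expi; rewrite -mulr_natr; ring.
  apply/seteqP; split => [_ [j _ <-]|z /= zn].
    by rewrite /= powE exprMn exprAC (prim_expr_order prim) expr1n mulr1.
  have : (z / l) ^+ n = 1 by rewrite expr_div_n zn divff // expf_neq0.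
  move=> /(prim_rootP prim)[j jE]; exists j; first exact: ltn_ord.
  by rewrite powE -jE mulrC divfK.
by split=> -[l l0 ->]; exists l => //; rewrite ngonE.
Qed.

End Trig.

(** * Multiplicities *)

Lemma mup_XnsubC (K : numFieldType) n (a l : K) :
  (0 < n)%N -> l != 0 -> root ('X^n - a%:P) l -> mup l ('X^n - a%:P) = 1%N.
Proof.
move=> n0 l0 rt.
have q0 : 'X^n - a%:P != 0 :> {poly K} by rewrite monic_neq0 ?monicXnsubC.
apply/eqP; rewrite eqn_leq -XsubC_dvd // dvdp_XsubCl rt andbT mup_leq //.
apply/negP => /dvdpP[t tE]; have := congr1 (fun p => p^`().[l]) tE.
rewrite /= derivB derivC derivXn subr0 hornerMn hornerXn expr2 !derivM.
rewrite hornerD !hornerM hornerXsubC hornerD !hornerM hornerXsubC subrr.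
rewrite !(mulr0, mul0r, addr0).
move=> /eqP.
by rewrite mulrn_eq0 expf_eq0 (negPf l0) andbF orbF; lia.
Qed.

Lemma mup_prod_XnsubC (K : numFieldType) n (cs : seq K) (l : K) :
  (0 < n)%N -> l != 0 -> uniq cs -> l ^+ n \in cs ->
  mup l (\prod_(a <- cs) ('X^n - a%:P)) = 1%N.
Proof.
move=> n0 l0 ucs lcs; rewrite (big_rem _ lcs) /=.
have rootXn a : root ('X^n - a%:P) l = (l ^+ n == a).
  by rewrite rootE hornerD hornerN hornerXn hornerC subr_eq0.
rewrite mupMl ?mup_XnsubC ?rootXn //.
rewrite rootE horner_prod prodf_seq_neq0; apply/allP => a /=.
rewrite mem_rem_uniq // => /andP[al _].
by rewrite -[_ == 0]/(root _ _) rootXn eq_sym.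
Qed.

Lemma ord_x_Xn_mul (K : numFieldType) (p : {poly int}) (q : {poly K}) e :
  map_poly intr p = 'X^e * q -> q.[0] != 0 -> ord_x p = e.
Proof.
move=> pE q0; have coefE i : (p`_i)%:~R = if (i < e)%N then 0 else q`_(i - e).
  by rewrite -coefXnM -pE coef_map.
have pe : p`_e != 0.
  by rewrite -(intr_eq0 K) coefE ltnn subnn -horner_coef0.
have es : (e < size p)%N.
  by rewrite ltnNge; apply: contraNN pe => h; rewrite nth_default.
have hp : has (fun c => c != 0) p.
  by apply/(has_nthP 0); exists e.
rewrite /ord_x; apply/eqP; rewrite eqn_leq; apply/andP; split.
  by rewrite leqNgt; apply/negP => /(before_find 0); rewrite pe.
rewrite leqNgt; apply/negP => h; have := nth_find 0 hp.
by rewrite -(intr_eq0 K) coefE h eqxx.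
Qed.

(** * Polygons in a set described by n-th powers *)

Section PowerSet.
Variables (R : realType) (n : nat) (us : seq R) (S : set R[i]).
Hypotheses (n0 : (0 < n)%N) (us_uniq : uniq us)
  (us_bound : {in us, forall u, 0 < u < 27 / 4}).
Hypothesis SE : forall z, z != 0 -> S z <-> exists2 u, u \in us & z ^+ n = u%:C.

Lemma nth_root_gt0 (u : R) : 0 < u -> exists2 x : R, 0 < x & x ^+ n = u.
Proof.
move=> u0; exists (u `^ n%:R^-1); first exact: powR_gt0.
by rewrite -powR_mulrn ?powR_ge0 // -powRrM mulVf ?powRr1 ?ltW // pnatr_eq0 -lt0n.
Qed.

Lemma power_neq0 (u : R) (z : R[i]) : u \in us -> z ^+ n = u%:C -> z != 0.
Proof.
move=> /us_bound /andP[u0 _] zu; apply: contraTneq u0 => z0; move: zu.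
rewrite z0 expr0n gtn_eqF //= => /eqP.
by rewrite eq_sym fmorph_eq0 => /eqP ->; rewrite ltxx.
Qed.

Lemma ngonsP (P : set R[i]) :
  ngons_in n S P <-> exists2 u, u \in us & P = [set z | z ^+ n = u%:C].
Proof.
split=> [[/(regular_ngonP _ n0)[l l0 PE] PS]| [u uus ->]].
  have [|u uus lu] := (SE l0).1; first by apply: PS; rewrite PE.
  by exists u => //; rewrite PE lu.
have /andP[u0 _] := us_bound uus.
have [x x0 xu] := nth_root_gt0 u0.
have xuC : x%:C ^+ n = u%:C by rewrite -rmorphXn /= xu.
split.
  by apply/(regular_ngonP _ n0); exists x%:C; rewrite ?xuC // fmorph_eq0 gt_eqF.
by move=> z /= zu; apply/SE; [exact: power_neq0 zu | exists u].
Qed.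

Lemma ngons_cover : \bigcup_(P in ngons_in n S) P = [set z | z != 0 /\ S z].
Proof.
apply/seteqP; split => [z [P /ngonsP[u uus ->] /= zu]|z [z0 Sz]].
  have z0 := power_neq0 uus zu.
  by split=> //; apply/SE => //; exists u.
have [u uus zu] := (SE z0).1 Sz.
by exists [set z | z ^+ n = u%:C] => //; apply/ngonsP; exists u.
Qed.

Lemma card_ngons : ngons_in n S #= `I_(size us).
Proof.
pose f i := [set z : R[i] | z ^+ n = (nth 0 us i)%:C].
have -> : ngons_in n S = f @` `I_(size us).
  apply/seteqP; split=> [P /ngonsP[u uus ->]|_ [i /= ius <-]].
    by exists (index u us); rewrite /f /= ?index_mem ?nth_index.
  by apply/ngonsP; exists (nth 0 us i) => //; rewrite mem_nth.
apply: inj_card_eq => i j; rewrite !inE /= => ius jus fij.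
have /andP[u0 _] := us_bound (mem_nth 0 ius).
have [x _ xu] := nth_root_gt0 u0.
have : f j x%:C by rewrite -fij /f /= -rmorphXn /= xu.
rewrite /f /= -rmorphXn /= xu => -[] /eqP.
by rewrite nth_uniq // => /eqP.
Qed.

Lemma ngon_location P : ngons_in n S P ->
  P `<=` open_disk ((27 / 4) `^ (n%:R^-1)) /\ exists2 x : R, 0 < x & P x%:C.
Proof.
move=> /ngonsP[u uus ->]; have /andP[u0 u274] := us_bound uus.
split; last first.
  by have [x x0 xu] := nth_root_gt0 u0; exists x => //=; rewrite -rmorphXn /= xu.
move=> z /= zu; rewrite /open_disk /=.
rewrite -(ltr_pXn2r n0) ?nnegrE ?normr_ge0 ?lecR ?powR_ge0 //.
rewrite -normrX zu -rmorphXn /= -powR_mulrn ?powR_ge0 // -powRrM.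
rewrite mulVf ?pnatr_eq0 -?lt0n // powRr1 ?divr_ge0 // normc_def /=.
by rewrite expr0n addr0 sqrtr_sqr gtr0_norm // ltcR.
Qed.

End PowerSet.

(** * The spectrum *)

Theorem theorem5p5 (R : realType) (n r : nat) (hn : (3 <= n)%N) (hr : (1 <= r)%N) :
  let A := adjC R n r in
  let ngons := ngons_in n (spectrum A) in
  [/\ spectrum A =
        [set z | z = 0 /\ (0 < ord_x (Phi n r))%N] `|` \bigcup_(P in ngons) P,
      alg_mult A 0 = ord_x (Phi n r),
      (forall z : R[i], spectrum A z -> z != 0 -> alg_mult A z = 1%N),
      ngons #= `I_((r + 2) %/ 3) &
      forall P : set R[i], ngons P ->
        P `<=` open_disk ((27 / 4) `^ (n%:R^-1)) /\
        exists2 x : R, 0 < x & P x%:C].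
Proof.
move=> A ngons.
have [us [us_uniq size_us us_bound gapE]] := gap_poly_factor R r.+2.
pose cs := [seq u%:C | u <- us].
pose e := (num_vertices n r - n * size us)%N.
have pE : char_poly A = 'X^e * \prod_(c <- cs) ('X^n - c%:P).
  rewrite big_map /A /e; have -> : n = (n - 2).+2 by lia.
  by apply: char_poly_adj => //; lia.
have n0 : (0 < n)%N by lia.
have cs_neq0 : (\prod_(c <- cs) ('X^n - c%:P)).[0] != 0.
  rewrite horner_prod big_map prodf_seq_neq0; apply/allP => u /us_bound /andP[u0 _] /=.
  rewrite hornerD hornerN hornerXn hornerC expr0n gtn_eqF //=.
  by rewrite sub0r oppr_eq0 fmorph_eq0 gt_eqF.
have ordE : ord_x (Phi n r) = e.
  apply: (@ord_x_Xn_mul R[i] _ _ e _ cs_neq0); rewrite -pE /A /adjC.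
  by rewrite /Phi map_char_poly.
have spE z : spectrum A z <-> root (char_poly A) z.
  by rewrite /spectrum /= eigenvalue_root_char.
have sp0 : spectrum A 0 <-> (0 < e)%N.
  rewrite spE pE rootM [X in _ || X]rootE (negPf cs_neq0) orbF rootE hornerXn expr0n.
  by case: (e) => //=; rewrite ?eqxx ?oner_eq0.
have spn0 z : z != 0 -> spectrum A z <-> exists2 u, u \in us & z ^+ n = u%:C.
  move=> z0; rewrite spE pE rootM rootE hornerXn expf_eq0 (negPf z0) andbF /=.
  rewrite rootE horner_prod prodf_seq_eq0 has_map; split.
    by move=> /hasP[u uus /=]; rewrite !hornerE subr_eq0 => /eqP; exists u.
  by case=> u uus zu; apply/hasP; exists u => //=; rewrite !hornerE zu subrr.
split.
- rewrite (ngons_cover n0 us_bound spn0) ordE; apply/seteqP; split=> z.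
    move=> Az; have [z0|z0] := eqVneq z 0; last by right.
    by left; split=> //; apply/sp0; rewrite -z0.
  by case=> [[-> /sp0]| []].
- rewrite ordE /alg_mult pE mupMl //.
  by have := mup_XsubCX e (0 : R[i]) 0; rewrite polyC0 subr0 eqxx.
- move=> z Az z0; rewrite /alg_mult pE mupMr; last first.
    by rewrite rootE hornerXn expf_eq0 (negPf z0) andbF.
  have [u uus zu] := (spn0 z z0).1 Az.
  apply: mup_prod_XnsubC => //; last by rewrite zu map_f.
  by rewrite map_inj_uniq //; exact: fmorph_inj.
- by rewrite addn2 -size_us; exact: (card_ngons n0 us_uniq us_bound spn0).
- exact: (ngon_location n0 us_bound spn0).
Qed.
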